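(* Let $R = \bigoplus_{n \geq 0} R_n$ be an $\mathbb{N}$-graded commutative ring with $R_0 = k$ a field. If $R$ is a Hilbert--Serre ring, then $$\dim_{\mathrm{gr}}(R) \leq \dim(R) \leq \operatorname{GKdim}_k(R) \leq d(R).$$ Moreover, if $R$ is in addition a domain, then $$\dim_{\mathrm{gr}}(R) \leq \dim(R) \leq \operatorname{tr.deg}_k(R) = \operatorname{GKdim}_k(R) \leq d(R).$$
   Context: All rings are commutative with identity, and $\mathbb{N}$ contains $0$. Let $R=\bigoplus_{n\ge 0}R_n$ be an $\mathbb{N}$-graded ring with $R_0=k$ a field. Hilbert--Serre ring: $R$ is a Hilbert--Serre ring if (1) $\dim_k R_n<\infty$ for all $n\in\mathbb{N}$; (2) the Poincaré series $P_R(t)=\sum_{n\ge 0}(\dim_k R_n)t^n$ has radius of convergence $1$ or $\infty$; (3) the set $D=\{d\in\mathbb{N}\mid \lim_{t\to 1-0}(1-t)^dP_R(t)<\infty\}$ is non-empty (here $t\to1-0$ is the limit from the left, and the condition means that the limit exists and is finite). In that case $d(R):=\min D$ is called the Hilbert--Serre dimension of $R$. $\dim(R)$ is the Krull dimension of $R$. $\dim_{\mathrm{gr}}(R)$, the graded Krull dimension, is the supremum of the lengths $r$ of chains $\mathfrak{p}_0\subsetneq\mathfrak{p}_1\subsetneq\cdots\subsetneq\mathfrak{p}_r$ of homogeneous prime ideals of $R$. When $R$ is a domain, $\operatorname{tr.deg}_k(R)$ is the transcendence degree over $k$ of the fraction field of $R$. Gelfand--Kirillov dimension: for a $k$-algebra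 $R$ and a finite-dimensional $k$-subspace $V\subseteq R$, let $V^n$ be the $k$-span of all products of $n$ elements of $V$ and $d_V(n)=\dim_k(k+V+\cdots+V^n)$. Then $\operatorname{GKdim}_k(R)=\sup_V\limsup_{n\to\infty}\frac{\log d_V(n)}{\log n}$, the supremum being over all finite-dimensional $k$-subspaces $V$ of $R$. *)

(* Defs.v *)
From HB Require Import structures.
From mathcomp Require Import all_boot all_order all_algebra.
From mathcomp Require Import all_classical all_reals all_analysis.
From mathcomp Require mpoly.
Import -(notations) mpoly.

Set Implicit Arguments.
Unset Strict Implicit.
Unset Printing Implicit Defensive.

Import Order.TTheory GRing.Theory Num.Theory.
Import numFieldNormedType.Exports.

Local Open Scope classical_set_scope.
Local Open Scope ring_scope.

Section Dimension.
Context {k : fieldType} {A : lmodType k}.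

Definition is_basis (V : {pred A}) (n : nat) (v : 'I_n -> A) : Prop :=
  (forall c : 'I_n -> k, \sum_(i < n) c i *: v i = 0 -> forall i, c i = 0) /\
  (forall x, x \in V <-> exists c : 'I_n -> k, x = \sum_(i < n) c i *: v i).

Definition has_dim (V : {pred A}) (n : nat) : Prop :=
  exists v : 'I_n -> A, is_basis V v.

Definition finite_dim (V : {pred A}) : Prop := exists n, has_dim V n.

(* Only meaningful when [finite_dim V] holds. *)
Definition vdim (V : {pred A}) : nat := xget 0%N [set n | has_dim V n].

End Dimension.

Section Grading.
Context {k : fieldType} {A : comAlgType k}.

(* A is the internal direct sum of the additive subgroups G n, with
   G i * G j contained in G (i + j), and G 0 is the image of k in A. *)
Record is_grading (G : nat -> {pred A}) : Prop := IsGrading {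
  grading_zmod : forall n, zmod_closed (G n);
  grading_mul : forall i j x y,
    x \in G i -> y \in G j -> x * y \in G (i + j)%N;
  grading_total : forall x, exists (n : nat) (f : nat -> A),
    (forall i, f i \in G i) /\ x = \sum_(i < n) f i;
  grading_direct : forall (n : nat) (f : nat -> A),
    (forall i, f i \in G i) -> \sum_(i < n) f i = 0 ->
    forall i, (i < n)%N -> f i = 0;
  grading_0 : forall x, x \in G 0%N <-> exists c : k, x = c%:A
}.

(* P is the sum of the P :&: G n. *)
Definition homogeneous (G : nat -> {pred A}) (P : {pred A}) : Prop :=
  forall x, x \in P -> exists (n : nat) (f : nat -> A),
    (forall i, f i \in G i /\ f i \in P) /\ x = \sum_(i < n) f i.

End Grading.

Section KrullDimension.
Context (R : realType) {A : comNzRingType}.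

(* There are primes P 0 < ... < P r satisfying Q; the values of P beyond r
   are irrelevant. *)
Definition prime_chain (Q : {pred A} -> Prop) (r : nat) : Prop :=
  exists P : nat -> prime_idealr A,
    (forall i, (i <= r)%N -> Q (P i)) /\
    (forall i, (i < r)%N ->
       {subset P i <= P i.+1} /\ ~ {subset P i.+1 <= P i}).

Definition chain_dim (Q : {pred A} -> Prop) : \bar R :=
  ereal_sup [set r%:R%:E | r in [set r | prime_chain Q r]].

End KrullDimension.

Definition krull_dim (R : realType) (A : comNzRingType) : \bar R :=
  chain_dim R (fun _ : {pred A} => True).

Definition graded_krull_dim (R : realType) (k : fieldType) (A : comAlgType k)
    (G : nat -> {pred A}) : \bar R :=
  chain_dim R (homogeneous G).

Section HilbertSerre.
Context (R : realType) {k : fieldType} {A : comAlgType k}.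
Variable G : nat -> {pred A}.

Definition poincare_coef (n : nat) : R := (vdim (G n))%:R.

Definition poincare_series (t : R) : R := limn (pseries poincare_coef t).

Definition radius_of_convergence (a : nat -> R) : \bar R :=
  ereal_sup [set r%:E | r in [set r : R | 0 <= r /\ cvgn (pseries a r)]].

(* The set D of exponents; the limit is taken in R, hence finite. *)
Definition pole_bounds : set nat :=
  [set d | cvg ((fun t : R => (1 - t) ^+ d * poincare_series t) @ 1^'-)].

Record hilbert_serre : Prop := HilbertSerre {
  hilbert_serre_fin : forall n, finite_dim (G n);
  hilbert_serre_radius :
    radius_of_convergence poincare_coef = 1%E \/
    radius_of_convergence poincare_coef = +oo%E;
  hilbert_serre_pole : pole_bounds !=set0
}.

(* The least element of [pole_bounds] (when there is one). *)
Definition hilbert_serre_dim : nat :=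
  xget 0%N [set d | pole_bounds d /\ forall e, pole_bounds e -> (d <= e)%N].

End HilbertSerre.

Section GelfandKirillov.
Context (R : realType) {k : fieldType}.

(* V^n; for n = 0 the empty product gives k. *)
Definition subspace_pow {A : comAlgType k} (V : {pred A}) (n : nat)
    : {pred A} :=
  fun x => `[< exists (m : nat) (c : 'I_m -> k) (v : 'I_m -> 'I_n -> A),
    (forall i j, v i j \in V) /\
    x = \sum_(i < m) c i *: \prod_(j < n) v i j >].

(* k + V + ... + V^n *)
Definition subspace_filtration {A : comAlgType k} (V : {pred A}) (n : nat)
    : {pred A} :=
  fun x => `[< exists f : nat -> A,
    (forall i, f i \in subspace_pow V i) /\ x = \sum_(i < n.+1) f i >].

Definition growth_rate {A : comAlgType k} (V : {pred A}) : \bar R :=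
  limn_esup (fun n : nat =>
    (ln (vdim (subspace_filtration V n))%:R / ln n%:R)%:E).

Definition GKdim (A : comAlgType k) : \bar R :=
  ereal_sup [set growth_rate V |
    V in [set V : {pred A} | submod_closed V /\ finite_dim V]].

End GelfandKirillov.

(* A copy of A carrying the integral domain structure given by domA, so that
   its field of fractions can be formed. Units and inverses are obtained by
   choice. *)
Definition domain_of (A : comNzRingType)
  (domA : GRing.integral_domain_axiom A) : Type := A.

Section DomainOf.
Variables (A : comNzRingType) (domA : GRing.integral_domain_axiom A).
Local Notation D := (domain_of domA).

HB.instance Definition _ := GRing.ComNzRing.on D.

Let unit : {pred D} := fun x => `[< exists y : D, y * x = 1 >].
Let inv (x : D) : D := xget x [set y : D | y * x = 1].

Fact domain_of_mulVx : {in unit, left_inverse 1 inv *%R}.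
Proof.
by move=> x /asboolP [y yx]; rewrite /inv; case: xgetP => [z _ //|/(_ y)].
Qed.

Fact domain_of_unitPl (x y : D) : y * x = 1 -> unit x.
Proof. by move=> yx; apply/asboolP; exists y. Qed.

Fact domain_of_invr_out : {in [predC unit], inv =1 id}.
Proof.
move=> x nux; rewrite /inv; case: xgetP => // y _ yx.
by case/negP: nux; apply: (domain_of_unitPl yx).
Qed.

HB.instance Definition _ := GRing.ComNzRing_hasMulInverse.Build D
  domain_of_mulVx domain_of_unitPl domain_of_invr_out.
HB.instance Definition _ := GRing.ComUnitRing_isIntegral.Build D domA.

End DomainOf.

Section TranscendenceDegree.
Context (R : realType) {k : fieldType}.

Definition alg_independent {F : fieldType} (f : {rmorphism k -> F}) (n : nat)
    (x : 'I_n -> F) : Prop :=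
  forall p : mpoly n k, mmap f x p = 0 -> p = 0.

Definition field_trdeg {F : fieldType} (f : {rmorphism k -> F}) : \bar R :=
  ereal_sup [set n%:R%:E | n in
    [set n : nat | exists x : 'I_n -> F, alg_independent f x]].

Variables (A : comAlgType k) (domA : GRing.integral_domain_axiom A).

Definition to_fraction_field : A -> {fraction (domain_of domA)} :=
  fun a => FracField.tofrac (a : domain_of domA).

HB.instance Definition _ := GRing.RMorphism.copy to_fraction_field
  (@FracField.tofrac (domain_of domA)).

Definition trdeg : \bar R := field_trdeg (to_fraction_field \o in_alg A).

End TranscendenceDegree.

(* Main.v *)
(* A chain of primes [P_0 < ... < P_r] yields [r] elements with linearly
   independent monomials: take [x_i] in [P_i] but not in [P_(i-1)]. Their
   monomials, or the homogenised monomials in numerators and denominators of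
   algebraically independent fractions, make the growth of a suitable subspace
   at least that of [n ^ r]. Conversely a finite-dimensional [V] lies in
   [A_0 + ... + A_m], so [k + V + ... + V^n] has dimension at most that of
   [A_0 + ... + A_(mn)], which is [O(n ^ d)] by the order of the pole of the
   Poincare series at 1. In a domain, let [w] be a maximal algebraically
   independent subfamily of a basis of [V]: for some [c <> 0], multiplication by
   [c ^ n] embeds [k + V + ... + V^n] into the span of products of a monomial in
   [w] with exponents [O(n)] and an element of a fixed finite set, so the growth
   is at most that of [n ^ size w]. *)

Require Import Defs.
From mathcomp Require Import all_boot all_order all_algebra.
From mathcomp Require Import all_classical all_reals all_analysis.
From mathcomp Require mpoly.
Import -(notations) mpoly.
From mathcomp Require Import lra.

Set Implicit Arguments.
Unset Strict Implicit.
Unset Printing Implicit Defensive.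

Import Order.TTheory GRing.Theory Num.Theory.
Import numFieldNormedType.Exports.

Local Open Scope ring_scope.

(** * Linear spans, independence and dimension *)

Section LinearSpan.
Context {k : fieldType} {A : lmodType k}.
Implicit Types (S T W : A -> Prop) (V : {pred A}) (u : seq A) (x y : A).

Definition lin_closed W : Prop :=
  W 0 /\ forall a x y, W x -> W y -> W (a *: x + y).

(** The span is the intersection of all linear subspaces containing [S], so that induction on a span
    is application to a suitable [W]; [S] may be infinite. *)
Definition lspan S x : Prop :=
  forall W, lin_closed W -> (forall y, S y -> W y) -> W x.

Lemma lspan_gen S x : S x -> lspan S x.
Proof. by move=> Sx W _; apply. Qed.

Lemma lspan_closed S : lin_closed (lspan S).
Proof.
split=> [W [] //|a x y Sx Sy W Wl SW].
by apply: Wl.2; [apply: Sx|apply: Sy].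
Qed.

Lemma lin_closedZ W a x : lin_closed W -> W x -> W (a *: x).
Proof. by move=> [W0 WD] Wx; rewrite -[_ *: _]addr0; apply: WD. Qed.

Lemma lin_closedD W x y : lin_closed W -> W x -> W y -> W (x + y).
Proof. by move=> [_ WD] Wx Wy; rewrite -[x]scale1r; apply: WD. Qed.

Lemma lin_closed_sum W (I : eqType) (s : seq I) (F : I -> A) :
  lin_closed W -> (forall i, i \in s -> W (F i)) -> W (\sum_(i <- s) F i).
Proof.
move=> Wl; elim: s => [|i s IHs] WF; first by rewrite big_nil; case: Wl.
rewrite big_cons; apply: lin_closedD => //.
  by apply: WF; rewrite mem_head.
by apply: IHs => j js; apply: WF; rewrite inE js orbT.
Qed.

Lemma lspan_trans S T x :
  (forall y, S y -> lspan T y) -> lspan S x -> lspan T x.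
Proof. by move=> ST Sx; apply: Sx => //; apply: lspan_closed. Qed.

Lemma lspan_sub S T x : (forall y, S y -> T y) -> lspan S x -> lspan T x.
Proof. by move=> ST; apply: lspan_trans => y /ST; apply: lspan_gen. Qed.

Lemma submod_lin_closed V : submod_closed V -> lin_closed (fun x => x \in V).
Proof. by case. Qed.

Lemma lspan_seqP u x : lspan (fun y => y \in u) x ->
  exists c : nat -> k, x = \sum_(i < size u) c i *: u`_i.
Proof.
move/(_ (fun x => exists c : nat -> k, x = \sum_(i < size u) c i *: u`_i)).
apply; first split.
- by exists (fun=> 0); rewrite big1 // => i _; rewrite scale0r.
- move=> a y z [c ->] [d ->]; exists (fun i => a * c i + d i).
  rewrite scaler_sumr -big_split; apply: eq_bigr => i _ /=.
  by rewrite scalerDl scalerA.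
- move=> y /(nthP 0) [i iu <-]; exists (fun j => (j == i)%:R).
  rewrite (bigD1 (Ordinal iu)) //= eqxx scale1r big1 ?addr0 // => j ji.
  by rewrite (_ : (_ == _) = false) ?scale0r //; apply/negbTE; apply: contra ji.
Qed.

Lemma size_index_ord n : size (index_enum 'I_n) = n.
Proof. by rewrite -sum1_size sum_nat_const card_ord muln1. Qed.

Definition lin_indep (I : eqType) (s : seq I) (g : I -> A) : Prop :=
  forall c : I -> k, \sum_(i <- s) c i *: g i = 0 ->
  forall i, i \in s -> c i = 0.

(** The coefficients of the [g i] in terms of [u] form a matrix; with more rows than columns it
    would have a nonzero left kernel vector, which is a linear relation between the [g i]. *)
Lemma lin_indep_size_le (I : eqType) (s : seq I) (g : I -> A) u :
  uniq s -> lin_indep s g ->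
  (forall i, i \in s -> lspan (fun y => y \in u) (g i)) -> (size s <= size u)%N.
Proof.
case: s => // i0 s'; set s := i0 :: s' => us gs su.
have /choice [C CP] : forall j : 'I_(size s), exists c : nat -> k,
    g (nth i0 s j) = \sum_(i < size u) c i *: u`_i.
  by move=> j; apply: lspan_seqP; apply: su; apply: mem_nth.
pose M := \matrix_(i < size s, j < size u) C i j.
rewrite leqNgt; apply/negP => us_lt.
have /rowV0Pn [v /sub_kermxP vM] : kermx M != 0.
  rewrite -mxrank_eq0 -lt0n mxrank_ker subn_gt0.
  exact: leq_ltn_trans (rank_leq_col M) us_lt.
(* The kernel vector is indexed by positions in [s]; since [s] has no repetitions, it transfers to a
   function of the elements. *)
pose c i := if insub (index i s) is Some j then v 0 j else 0.
have cE (j : 'I_(size s)) : c (nth i0 s j) = v 0 j.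
  by rewrite /c index_uniq // valK.
case/eqP; apply/rowP => j; rewrite mxE -cE.
apply: gs; last exact: mem_nth.
rewrite (big_nth i0) big_mkord.
under eq_bigr => i _ do rewrite cE CP scaler_sumr.
rewrite exchange_big big1 // => i _ /=.
under eq_bigr => l _ do rewrite scalerA.
rewrite -scaler_suml [X in X *: _](_ : _ = (v *m M) 0 i).
  by rewrite vM mxE scale0r.
by rewrite mxE; apply: eq_bigr => l _; rewrite mxE.
Qed.

Lemma is_basis_lin_indep V n (v : 'I_n -> A) :
  is_basis V v -> lin_indep (index_enum 'I_n) v.
Proof. by case=> vf _ c /vf c0 i _. Qed.

Lemma is_basis_lspan V n (v : 'I_n -> A) x :
  is_basis V v -> x \in V -> lspan (fun y => y \in codom v) x.
Proof.
case=> _ vV /vV [c ->]; apply: (lin_closed_sum (lspan_closed _)) => i _.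
apply: (lin_closedZ _ (lspan_closed _)).
by apply: lspan_gen; apply: codom_f.
Qed.

Lemma is_basis_mem V n (v : 'I_n -> A) i : is_basis V v -> v i \in V.
Proof.
case=> _ vV; apply/vV; exists (fun j => (j == i)%:R).
rewrite (bigD1 i) //= eqxx scale1r big1 ?addr0 // => j /negbTE ->.
by rewrite scale0r.
Qed.

Lemma has_dim_vdim V n : has_dim V n -> has_dim V (vdim V).
Proof. by move=> Vn; rewrite /vdim; case: xgetP => [? -> //|/(_ n)]; case. Qed.

(** An independent family in [V] of maximal length is a basis, and such lengths are bounded by
    [size u]. *)
Lemma has_dim_lspan V u : submod_closed V ->
  (forall x, x \in V -> lspan (fun y => y \in u) x) -> has_dim V (vdim V).
Proof.
move=> Vl Vu.
pose Q d := `[< exists v : 'I_d -> A,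
  lin_indep (index_enum 'I_d) v /\ forall i, v i \in V >].
have Q0 : exists d, Q d.
  exists 0%N; apply/asboolP; exists (fun=> 0).
  by split=> [c _ []|[]].
have Qle d : Q d -> (d <= size u)%N.
  move=> /asboolP [v [vf vV]].
  rewrite -[d]size_index_ord.
  apply: (lin_indep_size_le _ vf) => [|i _]; first exact: index_enum_uniq.
  by apply: Vu; apply: vV.
case: (ex_maxnP Q0 Qle) => d /asboolP [v [vf vV]] dmax.
apply: (@has_dim_vdim _ d); exists v; split=> [c c0 i|x].
  by apply: (vf c c0); rewrite mem_index_enum.
split=> [xV|[c ->]]; last first.
  apply: (lin_closed_sum (submod_lin_closed Vl)) => i _.
  exact: (lin_closedZ _ (submod_lin_closed Vl)).
apply: contrapT => xv.
suff /dmax : Q d.+1 by rewrite ltnn.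
apply/asboolP.
exists (fun i => if unlift ord0 i is Some j then v j else x); split; last first.
  by move=> i; case: unliftP.
move=> c; rewrite big_ord_recl unlift_none.
under eq_bigr => i _ do rewrite liftK.
have [c0|c0] := eqVneq (c ord0) 0.
  rewrite c0 scale0r add0r => /vf cl i _.
  by case: (unliftP ord0 i) => [j|] ->; rewrite // cl // mem_index_enum.
move=> /eqP; rewrite addr_eq0 => /eqP cx; case: xv.
exists (fun i => - (c ord0)^-1 * c (lift ord0 i)).
under eq_bigr => i _ do rewrite -scalerA.
by rewrite -scaler_sumr scaleNr -scalerN -cx scalerA mulVf // scale1r.
Qed.

Lemma vdim_le V u : submod_closed V ->
  (forall x, x \in V -> lspan (fun y => y \in u) x) -> (vdim V <= size u)%N.
Proof.
move=> Vl Vu; have [v vb] := has_dim_lspan Vl Vu.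
rewrite -[vdim V]size_index_ord.
apply: (lin_indep_size_le _ (is_basis_lin_indep vb)) => [|i _].
  exact: index_enum_uniq.
by apply: Vu; apply: is_basis_mem.
Qed.

Lemma lin_indep_le_vdim V (I : eqType) (s : seq I) (g : I -> A) :
  has_dim V (vdim V) -> uniq s -> lin_indep s g ->
  (forall i, i \in s -> g i \in V) -> (size s <= vdim V)%N.
Proof.
case=> v vb us gs sV; rewrite -(card_ord (vdim V)) -(size_codom v).
by apply: lin_indep_size_le gs _ => // i /sV; apply: is_basis_lspan.
Qed.

End LinearSpan.

Lemma lspan_mul {k : fieldType} {A : comAlgType k} (S T U : A -> Prop) x y :
  (forall s t, S s -> T t -> lspan U (s * t)) ->
  lspan S x -> lspan T y -> lspan U (x * y).
Proof.
move=> STU Sx Ty; have [U0 UD] := lspan_closed U.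
apply: (Sx (fun x => lspan U (x * y))); first split; first by rewrite mul0r.
  by move=> a s t Us Ut; rewrite mulrDl -scalerAl; apply: UD.
move=> s Ss; apply: (Ty (fun y => lspan U (s * y))).
  split; first by rewrite mulr0.
  by move=> a t t' Ut Ut'; rewrite mulrDr -scalerAr; apply: UD.
by move=> t Tt; apply: STU.
Qed.

(** * Boxes of exponent vectors *)

(** Exponents are bounded one by one and not in total degree, so that the count is exactly
    [N.+1 ^ e] and the first exponent splits off. *)
Fixpoint box (e N : nat) : seq (seq nat) :=
  if e is e'.+1 then [seq i :: b | i <- iota 0 N.+1, b <- box e' N]
  else [:: [::]].

Lemma boxS e N : box e.+1 N = [seq i :: b | i <- iota 0 N.+1, b <- box e N].
Proof. by []. Qed.

Lemma size_box e N : size (box e N) = (N.+1 ^ e)%N.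
Proof.
by elim: e => // e IHe; rewrite boxS size_allpairs size_iota IHe expnS.
Qed.

Lemma box_uniq e N : uniq (box e N).
Proof.
elim: e => // e IHe; rewrite boxS.
apply: allpairs_uniq => //; first exact: iota_uniq.
by move=> [i s] [j t] _ _ /= [-> ->].
Qed.

Lemma mem_box e N s : (s \in box e N) = (size s == e) && all (leq^~ N) s.
Proof.
elim: e s => [|e IHe] [|i s] //; rewrite boxS.
  by apply/allpairsP => -[[j t] [_ _]].
apply/allpairsP/idP => [[[j t] [jN tb [-> ->]]]|].
  move: jN tb; rewrite mem_iota IHe /= eqSS ltnS.
  by move=> -> /andP [-> ->].
move=> /and3P [se iN sN]; exists (i, s); split=> //.
  by rewrite mem_iota ltnS.
by rewrite IHe; apply/andP.
Qed.

(** * Monomials and chains of prime ideals *)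

Section Monomials.
Context {k : fieldType} {A : comAlgType k}.
Implicit Types (w : seq A) (al : seq nat).

Fixpoint mon w al : A :=
  if w is a :: w' then a ^+ head 0%N al * mon w' (behead al) else 1.

Lemma monE w al : mon w al = \prod_(i < size w) w`_i ^+ nth 0%N al i.
Proof.
elim: w al => [|a w IHw] al /=; first by rewrite big_ord0.
rewrite big_ord_recl IHw /=; rewrite nth0; congr (_ * _).
by apply: eq_bigr => i _; rewrite nth_behead.
Qed.

Lemma big_box e N (F : seq nat -> A) : \sum_(al <- box e.+1 N) F al =
  \sum_(i < N.+1) \sum_(al <- box e N) F (val i :: al).
Proof.
rewrite boxS big_allpairs_dep.
rewrite -(big_mkord predT (fun i => \sum_(al <- box e N) F (i :: al))).
by rewrite /index_iota subn0.
Qed.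

(** Algebraic independence of [w] over [k], phrased with exponent lists rather than polynomials. *)
Definition mon_indep w : Prop := forall N, lin_indep (box (size w) N) (mon w).

(** For a prime ideal [P] this is algebraic independence over [k] of the images of [w] in
    [A / P]. *)
Definition mon_indep_mod (P : {pred A}) w : Prop :=
  forall N (c : seq nat -> k),
    \sum_(al <- box (size w) N) c al *: mon w al \in P ->
  forall al, al \in box (size w) N -> c al = 0.

Lemma ideal_scale (P : prime_idealr A) a x : x \in P -> a *: x \in P.
Proof. by move=> xP; rewrite -mulr_algl; apply: idealMr. Qed.

(** Modulo [P1] only the constant term survives, so [f 0] lies in [P1] and vanishes. The remaining
    sum is a multiple of [x], which is not in the prime [P0]; cancelling [x] leaves the same
    situation for the shifted coefficients. *)
Lemma prime_sum_expr_eq0 (P0 P1 : prime_idealr A) x n (f : nat -> A) :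
  {subset P0 <= P1} -> x \in P1 -> x \notin P0 ->
  (forall i, f i \in P1 -> f i = 0) ->
  \sum_(i < n) x ^+ i * f i \in P0 -> forall i, (i < n)%N -> f i = 0.
Proof.
move=> P01 xP1 xP0; elim: n f => // n IHn f fP.
rewrite big_ord_recl expr0 mul1r.
under eq_bigr => i _ do rewrite lift0 exprS -mulrA.
rewrite -mulr_sumr => fxP.
have xsP1 : x * (\sum_(i < n) x ^+ i * f i.+1) \in P1.
  by rewrite mulrC; apply: idealMr.
have f0 : f 0%N = 0.
  apply: fP; have /P01 := fxP; rewrite rpredDr //.
move: fxP; rewrite f0 add0r prime_idealrM (negbTE xP0) /= => sP0.
by case=> [//|i]; apply: (IHn (fun i => f i.+1)) => // j; apply: fP.
Qed.

Lemma mon_indep_mod_cons (P0 P1 : prime_idealr A) x w :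
  {subset P0 <= P1} -> x \in P1 -> x \notin P0 ->
  mon_indep_mod P1 w -> mon_indep_mod P0 (x :: w).
Proof.
move=> P01 xP1 xP0 wP N c.
pose f i := \sum_(al <- box (size w) N) c (i :: al) *: mon w al.
rewrite big_box => sP.
have fP i : f i \in P1 -> forall al, al \in box (size w) N -> c (i :: al) = 0.
  exact: (wP N (fun al => c (i :: al))).
have f0 : forall i, (i < N.+1)%N -> f i = 0.
  apply: (prime_sum_expr_eq0 P01 xP1 xP0) => [i /fP c0|].
    by rewrite /f big_seq big1 // => al /c0 ->; rewrite scale0r.
  rewrite (_ : \sum_(_ < _) _ = \sum_(i < N.+1)
    \sum_(al <- box (size w) N) c (val i :: al) *: mon (x :: w) (val i :: al)) //.
  apply: eq_bigr => i _; rewrite mulr_sumr.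
  by apply: eq_bigr => al _; rewrite scalerAr.
rewrite boxS => _ /allpairsP [[i al] [iN alN ->]].
apply: fP alN; rewrite f0 ?rpred0 //.
by move: iN; rewrite mem_iota.
Qed.

(* Picking [x_i] in [P_i] but not in [P_(i-1)]: the term of lowest degree in
   [x_1] of a relation modulo [P_0] yields a relation between the remaining
   elements modulo [P_1]. *)
Lemma prime_chain_mon_indep Q r : @prime_chain A Q r ->
  exists w, size w = r /\ mon_indep w.
Proof.
case=> P [_ PS].
suff [w [wr wP]] : exists w, size w = r /\ mon_indep_mod (P 0%N) w.
  by exists w; split=> // N c c0; apply: wP; rewrite c0 rpred0.
elim: r P PS => [|r IHr] P PS.
  exists [::]; split=> // N c; rewrite /= big_seq1 => cP al.
  rewrite inE => /eqP ->; apply: contraTeq cP => c0.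
  apply/negP => /(ideal_scale (c [::])^-1).
  by rewrite scalerA mulVf // scale1r; apply/negP; rewrite idealr1.
have [|w [wr wP]] := IHr (fun i => P i.+1); first by move=> i ir; apply: PS.
have [P01 P10] := PS 0%N isT.
have [x xP1 xP0] : exists2 x, x \in P 1%N & x \notin P 0%N.
  apply: contrapT => nx; apply: P10 => x xP1.
  by apply: contrapT => /negP xP0; apply: nx; exists x.
exists (x :: w); split; first by rewrite /= wr.
exact: mon_indep_mod_cons P01 xP1 xP0 wP.
Qed.

End Monomials.

(** * Products of elements of a subspace and the filtration they span *)

Section Products.
Context {k : fieldType} {A : comAlgType k}.
Implicit Types (V : {pred A}) (u w : seq A) (al : seq nat).

(** Products as lists, without coefficients or double indices; by [subspace_powP] they span
    [subspace_pow V n]. *)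
Definition nprod V n (x : A) : Prop :=
  exists s : seq A, [/\ size s = n, {subset s <= V} & x = \prod_(y <- s) y].

Lemma nprodM V m n x y : nprod V m x -> nprod V n y -> nprod V (m + n) (x * y).
Proof.
move=> [s [sm sV ->]] [t [tn tV ->]]; exists (s ++ t); split.
- by rewrite size_cat sm tn.
- by move=> z; rewrite mem_cat => /orP [/sV|/tV].
- by rewrite big_cat.
Qed.

Lemma nprod0 V : nprod V 0 1.
Proof. by exists [::]; rewrite big_nil. Qed.

Lemma nprod1 V x : x \in V -> nprod V 1 x.
Proof.
by exists [:: x]; rewrite big_seq1; split=> // y; rewrite inE => /eqP ->.
Qed.

Lemma nprodX V m x : x \in V -> nprod V m (x ^+ m).
Proof.
move=> xV; elim: m => [|m IHm]; first exact: nprod0.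
by rewrite exprS -add1n; apply: nprodM => //; apply: nprod1.
Qed.

Lemma nprod_prod V m r (f : nat -> A) :
  (forall i, (i < r)%N -> nprod V m (f i)) -> nprod V (r * m) (\prod_(i < r) f i).
Proof.
elim: r => [|r IHr] fV; first by rewrite big_ord0; apply: nprod0.
rewrite big_ord_recr mulSn addnC; apply: nprodM; last exact: fV.
by apply: IHr => i ir; apply: fV; apply: ltnW.
Qed.

Lemma subspace_pow_closed V n : lin_closed (fun x => x \in subspace_pow V n).
Proof.
split=> [|a x y /asboolP [m1 [c1 [v1 [v1V ->]]]]
                   /asboolP [m2 [c2 [v2 [v2V ->]]]]].
  apply/asboolP; exists 0%N, (fun=> 0), (fun _ _ => 0).
  by split=> [[]|] //; rewrite big_ord0.
apply/asboolP; exists (m1 + m2)%N.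
exists (fun i =>
  match @fintype.split m1 m2 i with inl j => a * c1 j | inr j => c2 j end).
exists (fun i =>
  match @fintype.split m1 m2 i with inl j => v1 j | inr j => v2 j end).
split=> [i j|]; first by case: (fintype.split i).
rewrite big_split_ord /= scaler_sumr; congr (_ + _); apply: eq_bigr => i _.
  by rewrite (unsplitK (inl i)) scalerA.
by rewrite (unsplitK (inr i)).
Qed.

Lemma subspace_powP V n x : x \in subspace_pow V n <-> lspan (nprod V n) x.
Proof.
split=> [/asboolP [m [c [v [vV ->]]]]|].
  apply: (lin_closed_sum (lspan_closed _)) => i _.
  apply: (lin_closedZ _ (lspan_closed _)); apply: lspan_gen.
  exists [seq v i j | j <- index_enum 'I_n]; split.
  - by rewrite size_map size_index_ord.
  - by move=> _ /mapP [j _ ->].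
  - by rewrite big_map.
move/(_ (fun y => y \in subspace_pow V n)).
apply; first exact: subspace_pow_closed.
move=> _ [s [sn sV ->]]; apply/asboolP.
exists 1%N, (fun=> 1), (fun _ j => nth 0 s j); split=> [_ j|].
  by apply: sV; apply: mem_nth; rewrite sn.
by rewrite big_ord1 scale1r (big_nth 0) sn big_mkord.
Qed.

Lemma subspace_filtration_closed V n : submod_closed (subspace_filtration V n).
Proof.
split=> [|a x y /asboolP [f [fV ->]] /asboolP [g [gV ->]]].
  apply/asboolP; exists (fun=> 0); split; last by rewrite big1.
  by move=> i; case: (subspace_pow_closed V i).
apply/asboolP; exists (fun i => a *: f i + g i); split.
  by move=> i; have [_] := subspace_pow_closed V i; apply.
by rewrite scaler_sumr -big_split.
Qed.

Lemma subspace_filtrationP V n x : x \in subspace_filtration V n <->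
  lspan (fun y => exists2 i, (i <= n)%N & nprod V i y) x.
Proof.
split=> [/asboolP [f [fV ->]]|].
  apply: (lin_closed_sum (lspan_closed _)) => i _.
  have /subspace_powP := fV i; apply: lspan_sub => y yV.
  by exists i => //; rewrite -ltnS.
move/(_ (fun y => y \in subspace_filtration V n)).
apply; first exact/submod_lin_closed/subspace_filtration_closed.
move=> y [i iin iV]; apply/asboolP.
exists (fun j => if j == i then y else 0); split.
  move=> j; case: eqP => [->|_]; last by case: (subspace_pow_closed V j).
  by apply/subspace_powP; apply: lspan_gen.
rewrite -ltnS in iin; rewrite (bigD1 (Ordinal iin)) //= eqxx.
rewrite big1 ?addr0 // => j ji.
by rewrite (_ : (_ == _) = false) //; apply/negbTE; apply: contra ji.
Qed.

Lemma mon_incr w al j :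
  (j < size w)%N -> mon w (incr_nth al j) = w`_j * mon w al.
Proof.
move=> jw; rewrite !monE (bigD1 (Ordinal jw)) //=.
rewrite [in RHS](bigD1 (Ordinal jw)) //=.
rewrite nth_incr_nth eqxx exprS mulrA; congr (_ * _).
apply: eq_bigr => i ij; rewrite nth_incr_nth (_ : (j == i) = false) //.
by apply/negbTE; apply: contra ij => /eqP ji; apply/eqP/val_inj.
Qed.

Lemma box_nthP e N al :
  al \in box e N <-> size al = e /\ forall i, (nth 0%N al i <= N)%N.
Proof.
rewrite mem_box; split=> [/andP [/eqP <- /(all_nthP 0%N) aN]|[<- aN]].
  split=> // i; have [/aN //|ia] := ltnP i (size al).
  by rewrite nth_default.
by rewrite eqxx; apply/(all_nthP 0%N) => i _.
Qed.

Lemma box_incr e N al j :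
  al \in box e N -> (j < e)%N -> incr_nth al j \in box e N.+1.
Proof.
move=> /box_nthP [ae aN] je; apply/box_nthP; split=> [|i].
  by rewrite size_incr_nth ae je.
rewrite nth_incr_nth; case: (j == i) => /=; first by rewrite add1n ltnS.
by rewrite add0n; apply: leqW.
Qed.

Lemma box_le e M N al : (M <= N)%N -> al \in box e M -> al \in box e N.
Proof.
move=> MN /box_nthP [ae aM]; apply/box_nthP; split=> // i.
exact: leq_trans (aM i) MN.
Qed.

Definition mons w N (x : A) : Prop :=
  exists2 al, al \in box (size w) N & x = mon w al.

Lemma mons1 w N : mons w N 1.
Proof.
exists (nseq (size w) 0%N).
  by apply/box_nthP; rewrite size_nseq; split=> // i; rewrite nth_nseq if_same.
by rewrite monE big1 // => i _; rewrite nth_nseq if_same expr0.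
Qed.

Lemma mons_le w M N x : (M <= N)%N -> mons w M x -> mons w N x.
Proof. by move=> MN [al alM ->]; exists al => //; apply: box_le MN alM. Qed.

(** Multiplication by a generator from [u] raises one exponent by one, so after [n] factors every
    exponent is at most [n]. *)
Lemma nprod_mons V u n x :
  (forall y, y \in V -> lspan (fun z => z \in u) y) ->
  nprod V n x -> lspan (mons u n) x.
Proof.
move=> Vu [s [<- sV ->]]; elim: s sV => [|y s IHs] sV.
  by rewrite big_nil; apply: lspan_gen; apply: mons1.
rewrite big_cons.
apply: (lspan_mul _ (Vu y _) (IHs _)); last 2 first.
- by apply: sV; rewrite mem_head.
- by move=> z zs; apply: sV; rewrite inE zs orbT.
move=> _ _ /(nthP 0) [j ju <-] [al alu ->]; apply: lspan_gen.
exists (incr_nth al j); first exact: box_incr.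
by rewrite mon_incr.
Qed.

Lemma subspace_filtration_mons V u n x :
  (forall y, y \in V -> lspan (fun z => z \in u) y) ->
  x \in subspace_filtration V n -> lspan (mons u n) x.
Proof.
move=> Vu /subspace_filtrationP; apply: lspan_trans => y [i iin].
by move=> /(nprod_mons Vu); apply: lspan_sub => z; apply: mons_le.
Qed.

Lemma mons_seq w N x : lspan (mons w N) x ->
  lspan (fun y => y \in [seq mon w al | al <- box (size w) N]) x.
Proof. by apply: lspan_sub => _ [al alN ->]; apply: map_f. Qed.

Lemma finite_dim_lspan V : finite_dim V ->
  exists u, (forall y, y \in V -> lspan (fun z => z \in u) y) /\
    {subset u <= V}.
Proof.
move=> [n [v vb]]; exists (codom v); split=> [y|_ /codomP [i ->]].
  exact: is_basis_lspan.
exact: is_basis_mem vb.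
Qed.

Lemma has_dim_filtration V n : finite_dim V ->
  has_dim (subspace_filtration V n) (vdim (subspace_filtration V n)).
Proof.
move=> /finite_dim_lspan [u [Vu _]].
apply: has_dim_lspan; first exact: subspace_filtration_closed.
by move=> x /(subspace_filtration_mons Vu)/mons_seq; apply.
Qed.

End Products.

(** * Growth rates and bounds for the Gelfand-Kirillov dimension *)

Section Growth.
Context (R : realType) {k : fieldType} {A : comAlgType k}.
Implicit Types (V : {pred A}).

Lemma cst_le_eps_ln (K eps : R) : 0 < eps ->
  exists N, forall n, (N <= n)%N -> 0 < ln (n%:R : R) /\ K <= eps * ln n%:R.
Proof.
(* Exceeding 2 makes [ln n] positive; exceeding [expR (K / eps)] gives the inequality. *)
move=> e0; set M : R := Num.max (expR (K / eps)) 2.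
have M0 : 0 <= M by rewrite le_max expR_ge0.
exists (Num.Def.archi_bound M) => n Mn.
have : M < n%:R by apply: lt_le_trans (archi_boundP M0) _; rewrite ler_nat.
rewrite gt_max => /andP [Kn n2].
have n0 : n%:R \is @Num.pos R by rewrite posrE; apply: lt_trans n2.
split; first by apply: ln_gt0; apply: lt_trans n2; rewrite ltr1n.
by rewrite mulrC -ler_pdivrMr // -[_ / _]expRK ler_ln ?posrE ?expR_gt0 // ltW.
Qed.

(** After taking logarithms, [n ^ e] contributes [e] and [C] contributes [ln C / ln n], which tends
    to 0. *)
Lemma growth_rate_le V (C : R) n0 e : 1 <= C ->
  (forall n, (n0 <= n)%N ->
    (vdim (subspace_filtration V n))%:R <= C * n%:R ^+ e) ->
  (growth_rate R V <= (e%:R)%:E)%E.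
Proof.
move=> C1 VC; apply/lee_addgt0Pr => eps eps0.
have [N NP] := cst_le_eps_ln (ln C) eps0.
apply: ge_ereal_inf.
exists (ereal_sup [set (ln (vdim (subspace_filtration V n))%:R / ln n%:R)%:E
  | n in [set n | (maxn N n0 <= n)%N]])%classic.
  by exists [set n | (maxn N n0 <= n)%N]%classic => //; exists (maxn N n0).
apply/ereal_supP => _ [n /= + <-]; rewrite geq_max => /andP [/NP [lnn Ce] /VC Vn].
have n_gt0 : 0 < n%:R :> R.
  by rewrite ltNge; apply: contraTN lnn => /ln0 ->; rewrite ltxx.
rewrite -EFinD lee_fin ler_pdivrMr // mulrDl.
apply: (@le_trans _ _ (ln (C * n%:R ^+ e))).
  (* [ln 0] is 0 by convention, so dimension 0 is treated apart. *)
  have [->|d0] := posnP (vdim (subspace_filtration V n)).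
    have n1 : 1 <= n%:R :> R by rewrite ler1n -(ltr0n R).
    rewrite ln0 // ln_ge0 //; apply: (le_trans C1).
    by rewrite ler_peMr ?exprn_ege1 // (le_trans ler01).
  rewrite ler_ln // ?posrE ?ltr0n //.
  by rewrite mulr_gt0 ?exprn_gt0 // (lt_le_trans ltr01).
have C0 : 0 < C by apply: lt_le_trans C1.
by rewrite lnM ?posrE ?exprn_gt0 // lnXn // mulr_natl addrC lerD2l.
Qed.

(** For [r > 0], [(n %/ r).+1] exceeds [n / r], so the logarithm is at least [r (ln n - ln r)], and
    [r ln r / ln n] tends to 0. *)
Lemma growth_rate_ge V r :
  (forall n, ((n %/ r).+1 ^ r <= vdim (subspace_filtration V n))%N) ->
  ((r%:R)%:E <= growth_rate R V)%E.
Proof.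
move=> rV; apply/lee_subgt0Pr => eps eps0.
apply/ereal_infP => _ [/= W [N0 _ WN] <-].
have [N NP] := cst_le_eps_ln (r%:R * ln (r%:R : R)) eps0.
(* One index in the tail [W], large enough to absorb [r ln r], bounds the supremum over [W] from
   below. *)
set n := maxn N N0.
apply: (@le_trans _ _
  (ln (vdim (subspace_filtration V n))%:R / ln n%:R)%:E); last first.
  by apply: ereal_sup_ubound; exists n => //; apply: WN; rewrite /= leq_maxr.
have [lnn re] := NP n (leq_maxl _ _).
have n_gt0 : 0 < n%:R :> R.
  by rewrite ltNge; apply: contraTN lnn => /ln0 ->; rewrite ltxx.
rewrite -EFinB lee_fin ler_pdivlMr // mulrBl.
apply: (@le_trans _ _ (r%:R * (ln n%:R - ln (r%:R : R)))).
  by rewrite mulrBr lerD2l lerN2.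
apply: (@le_trans _ _ (ln (((n %/ r).+1 ^ r)%:R : R))); last first.
  have d0 : (0 < (n %/ r).+1 ^ r)%N by rewrite expn_gt0.
  by rewrite ler_ln ?posrE ?ltr0n ?ler_nat //; apply: leq_trans (rV n).
rewrite natrX lnXn ?ltr0n // -[ln _ *+ _]mulr_natl.
have [->|r0] := posnP r; first by rewrite !mul0r.
rewrite ler_wpM2l // -ln_div ?posrE // ?ltr0n //.
rewrite ler_ln ?posrE ?divr_gt0 // ?ltr0n //.
rewrite ler_pdivrMr ?ltr0n // -natrM ler_nat.
by apply: ltnW; rewrite ltn_ceil.
Qed.

(** Formally, these products are the monomials in the fractions [a i / b i], multiplied by the
    common denominator [\prod_i b i ^ m]; [b = 1] gives ordinary monomials. They are [m.+1 ^ r]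
    products of [r * m] elements of the span of the [a i] and [b i], and [m = n %/ r] fits them into
    step [n] of the filtration. *)
Lemma GKdim_ge (a b : nat -> A) r :
  (forall m, lin_indep (box r m)
    (fun al => \prod_(i < r) (a i ^+ nth 0%N al i * b i ^+ (m - nth 0%N al i)))) ->
  ((r%:R)%:E <= GKdim R A)%E.
Proof.
move=> abf.
pose u := [seq a i | i <- iota 0 r] ++ [seq b i | i <- iota 0 r].
pose V : {pred A} := fun x => `[< lspan (fun y => y \in u) x >].
have VP x : x \in V <-> lspan (fun y => y \in u) x by split=> /asboolP.
have Vl : submod_closed V.
  split=> [|c x y]; first by apply/VP; case: (lspan_closed (fun y => y \in u)).
  by rewrite !VP; apply: (lspan_closed _).2.
have Vfin : finite_dim V.
  by exists (vdim V); apply: (has_dim_lspan Vl) => x /VP; apply.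
have [aV bV] : (forall i, (i < r)%N -> a i \in V) /\
    (forall i, (i < r)%N -> b i \in V).
  split=> i ir; apply/VP; apply: lspan_gen; rewrite mem_cat; apply/orP;
    [left|right];
    by apply: map_f; rewrite mem_iota.
apply: (@le_trans _ _ (growth_rate R V)); last first.
  by apply: ereal_sup_ubound; exists V.
apply: growth_rate_ge => n; rewrite -size_box.
apply: (lin_indep_le_vdim (has_dim_filtration n Vfin) (box_uniq _ _) (abf _)).
move=> al /box_nthP [_ aln]; apply/subspace_filtrationP; apply: lspan_gen.
exists (r * (n %/ r))%N; first by rewrite mulnC leq_divM.
apply: (nprod_prod (f := fun i =>
  a i ^+ nth 0%N al i * b i ^+ (n %/ r - nth 0%N al i))) => i ir.
rewrite -{1}(subnKC (aln i)); apply: nprodM; apply: nprodX.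
  exact: aV.
exact: bV.
Qed.

Lemma krull_le_GKdim : (krull_dim R A <= GKdim R A)%E.
Proof.
apply/ereal_supP => _ [r /prime_chain_mon_indep [w [<- wf]] <-].
apply: (GKdim_ge (a := nth 0 w) (b := fun=> 1)) => m c c0.
apply: (wf m); rewrite -[RHS]c0; apply: eq_bigr => al _; rewrite monE.
by congr (_ *: _); apply: eq_bigr => i _; rewrite expr1n mulr1.
Qed.

Lemma GKdim_le e :
  (forall V, submod_closed V -> finite_dim V -> exists (C : R) n0, 1 <= C /\
    forall n, (n0 <= n)%N ->
      (vdim (subspace_filtration V n))%:R <= C * n%:R ^+ e) ->
  (GKdim R A <= (e%:R)%:E)%E.
Proof.
move=> VC; apply/ereal_supP => _ [V [Vl /(VC V Vl) [C [n0 [C1 Cn]]]] <-].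
exact: growth_rate_le C1 Cn.
Qed.

End Growth.

(** * Partial sums of a power series with a pole at 1 *)

(** Bernoulli's inequality [(1 - h) ^ n >= 1 - n h] at [h = 1 / (2 N)], [n = N]. *)
Lemma bernoulli_half {R : realType} (N : nat) : (0 < N)%N ->
  2^-1 <= (1 - (2 * N%:R)^-1 : R) ^+ N.
Proof.
move=> N0; set h := (2 * N%:R)^-1.
have N0' : N%:R != 0 :> R by rewrite pnatr_eq0 -lt0n.
have h0 : 0 <= h by rewrite invr_ge0 mulr_ge0.
have h1 : h <= 1.
  by rewrite invf_le1 ?mulr_gt0 ?ltr0n // -natrM ler1n muln_gt0.
apply: (@le_trans _ _ (1 - N%:R * h)).
  by rewrite /h invfM mulrCA divff // mulr1; lra.
elim: (N) => [|n IHn]; first by rewrite mul0r subr0 expr0.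
rewrite exprS; apply: (@le_trans _ _ ((1 - h) * (1 - n%:R * h))).
  have : 0 <= n%:R * h * h :> R by rewrite !mulr_ge0.
  by rewrite -natr1; nra.
by rewrite ler_wpM2l // subr_ge0.
Qed.

(* Evaluate the series at [t = 1 - 1 / (2 N)], where [t ^ N >= 1 / 2]. *)
Lemma partial_sum_bound {R : realType} (a : nat -> R) d :
  (forall i, 0 <= a i) ->
  (forall t, 0 < t < 1 -> cvgn (pseries a t)) ->
  cvg ((fun t : R => (1 - t) ^+ d * limn (pseries a t)) @ 1^'-)%classic ->
  exists C N0, 1 <= C /\ forall N, (N0 <= N)%N ->
    \sum_(i < N.+1) a i <= C * N%:R ^+ d.
Proof.
move=> a0 acvg /cvgrPdist_le /(_ 1 ltr01) [e /= e0 He].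
set L := lim _ in He.
(* From this index on, [1 / (2 N)] is below the radius [e] within which the product is at most
   [L + 1]. Of [2 ^ d.+1], one factor 2 comes from [t ^ N >= 1 / 2] and [2 ^ d] from
   [1 / (1 - t) ^ d = (2 N) ^ d]. *)
exists (Num.max 1 (2 ^+ d.+1 * (L + 1))), (Num.Def.archi_bound e^-1).+1.
split=> [|N Ne]; first by rewrite le_max lexx.
have N0 : (0 < N)%N by apply: leq_trans Ne.
have N0' : 0 < N%:R :> R by rewrite ltr0n.
have eN : e^-1 < N%:R.
  apply: lt_le_trans (archi_boundP _) _; first by rewrite invr_ge0 ltW.
  by rewrite ler_nat ltnW.
pose h : R := (2 * N%:R)^-1.
have h0 : 0 < h by rewrite invr_gt0 mulr_gt0.
have he : h < e.
  rewrite /h -[e]invrK ltf_pV2 ?posrE ?invr_gt0 ?mulr_gt0 //.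
  by apply: lt_le_trans eN _; rewrite ler_peMl ?ler1n // ltW.
have h1 : h < 1.
  rewrite invf_lt1 ?mulr_gt0 // -natrM ltr1n.
  by case: (N) N0 => // n _; rewrite mulnS.
have t01 : 0 < 1 - h < 1 by apply/andP; split; lra.
have PL : h ^+ d * limn (pseries a (1 - h)) <= L + 1.
  have := He (1 - h); rewrite /ball /= opprB addrC subrK gtr0_norm // => /(_ he).
  case/andP: t01 => _ t1 /(_ t1).
  by rewrite ler_norml => /andP [H _]; lra.
have SP : series (fun i => a i * (1 - h) ^+ i) N.+1 <= limn (pseries a (1 - h)).
  apply: nondecreasing_cvgn_le; last exact: acvg.
  apply/nondecreasing_seqP => n; rewrite /pseries !seriesEnat /= big_nat_recr //=.
  by rewrite lerDl mulr_ge0 // exprn_ge0 // subr_ge0 ltW.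
apply: (@le_trans _ _ (2 * limn (pseries a (1 - h)))).
  apply: le_trans (ler_wpM2l _ SP); last by [].
  rewrite seriesEnat /= big_mkord mulr_sumr ler_sum // => i _.
  rewrite mulrCA ler_peMr //.
  have : 2^-1 <= (1 - h) ^+ i.
    apply: le_trans (bernoulli_half N0) _.
    case/andP: t01 => t0 t1.
    by rewrite ler_wiXn2l ?ltW // -ltnS.
  lra.
apply: (@le_trans _ _ (2 ^+ d.+1 * (L + 1) * N%:R ^+ d)); last first.
  by rewrite ler_wpM2r ?exprn_ge0 ?ler0n // le_max lexx orbT.
rewrite exprS -!mulrA ler_wpM2l //.
have -> : 2 ^+ d * ((L + 1) * N%:R ^+ d) = (L + 1) / h ^+ d.
  by rewrite /h exprVn invrK exprMn mulrCA.
by rewrite ler_pdivlMr ?exprn_gt0 // mulrC.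
Qed.

(** * Upper bound by the Hilbert-Serre dimension *)

Section HilbertSerre.
Context (R : realType) {k : fieldType} {A : comAlgType k}.
Variables (G : nat -> {pred A}).
Hypotheses (grG : is_grading G) (hsG : hilbert_serre R G).

(** Homogeneous elements only; it is the span of this predicate that is [A_0 + ... + A_N]. *)
Definition graded_le N (x : A) : Prop := exists2 i, (i <= N)%N & x \in G i.

Lemma graded_le_widen M N x :
  (M <= N)%N -> lspan (graded_le M) x -> lspan (graded_le N) x.
Proof.
by move=> MN; apply: lspan_sub => y [i iM yi]; exists i => //; apply: leq_trans MN.
Qed.

Lemma graded_le_mul M N x y : lspan (graded_le M) x -> lspan (graded_le N) y ->
  lspan (graded_le (M + N)) (x * y).
Proof.
apply: lspan_mul => s t [i iM si] [j jN tj]; apply: lspan_gen.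
by exists (i + j)%N; [rewrite leq_add|apply: (grading_mul grG)].
Qed.

Lemma graded_le_ex x : exists N, lspan (graded_le N) x.
Proof.
have [n [f [fG ->]]] := grading_total grG x; exists n.
apply: (lin_closed_sum (lspan_closed _)) => i _; apply: lspan_gen.
by exists i => //; apply: ltnW.
Qed.

Lemma finite_dim_graded_le (V : {pred A}) : finite_dim V ->
  exists N, forall x, x \in V -> lspan (graded_le N) x.
Proof.
move=> /finite_dim_lspan [u [Vu _]].
suff [N NP] : exists N, forall x, x \in u -> lspan (graded_le N) x.
  by exists N => x /Vu; apply: lspan_trans.
elim: u {Vu} => [|y u [N NP]]; first by exists 0%N.
have [M MP] := graded_le_ex y; exists (maxn M N) => x.
rewrite inE => /predU1P [->|/NP].
  exact: graded_le_widen (leq_maxl _ _) MP.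
exact: graded_le_widen (leq_maxr _ _).
Qed.

Lemma nprod_graded_le (V : {pred A}) N n x :
  (forall x, x \in V -> lspan (graded_le N) x) ->
  nprod V n x -> lspan (graded_le (n * N)) x.
Proof.
move=> VN [s [<- sV ->]]; elim: s sV => [|y s IHs] sV.
  rewrite big_nil mul0n; apply: lspan_gen; exists 0%N => //.
  by apply/(grading_0 grG); exists 1; rewrite scale1r.
rewrite big_cons mulSn; apply: graded_le_mul.
  by apply: VN; apply: sV; rewrite mem_head.
by apply: IHs => z zs; apply: sV; rewrite inE zs orbT.
Qed.

Lemma graded_le_gen N : exists u,
  (size u <= \sum_(i < N.+1) vdim (G i))%N /\
  forall x, lspan (graded_le N) x -> lspan (fun y => y \in u) x.
Proof.
suff [u [us uP]] : exists u, (size u <= \sum_(i < N.+1) vdim (G i))%N /\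
    forall i x, (i < N.+1)%N -> x \in G i -> lspan (fun y => y \in u) x.
  by exists u; split=> // x; apply: lspan_trans => y [i iN]; apply: uP.
elim: (N.+1) => [|n [u [us uP]]]; first by exists [::]; rewrite big_ord0.
have [d /has_dim_vdim [v vb]] := hilbert_serre_fin hsG n.
exists (u ++ codom v); split.
  by rewrite size_cat big_ord_recr leq_add // size_codom card_ord.
move=> i x; rewrite ltnS leq_eqVlt => /predU1P [->|iN].
  by move=> /(is_basis_lspan vb); apply: lspan_sub => y; rewrite mem_cat orbC => ->.
by move=> /(uP _ _ iN); apply: lspan_sub => y; rewrite mem_cat => ->.
Qed.

(** The radius is 1 or infinite, so the series converges at some point beyond [t]. *)
Lemma poincare_cvg t : 0 < t < 1 -> cvgn (pseries (poincare_coef R G) t).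
Proof.
move=> /andP [t0 t1].
have : (t%:E < radius_of_convergence (poincare_coef R G))%E.
  by case: (hilbert_serre_radius hsG) => ->; rewrite ?lte_fin ?ltry.
move=> /ereal_sup_gt [_ [r [r0 rc] <-]]; rewrite lte_fin => tr.
by apply: is_cvg_pseries_inside rc _; rewrite !ger0_norm // ltW.
Qed.

Lemma hilbert_serre_dim_pole : pole_bounds R G (hilbert_serre_dim R G).
Proof.
rewrite /hilbert_serre_dim; case: xgetP => [d _ []//|].
have [d dP] := hilbert_serre_pole hsG.
have ex : exists d, `[< pole_bounds R G d >] by exists d; apply/asboolP.
case: (ex_minnP ex) => m /asboolP mP mmin /(_ m) [].
by split=> // e eP; apply: mmin; apply/asboolP.
Qed.

Lemma GKdim_le_hilbert_serre_dim :
  (GKdim R A <= ((hilbert_serre_dim R G)%:R : R)%:E)%E.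
Proof.
apply: GKdim_le => V Vl Vfin.
have [N0 VN0] := finite_dim_graded_le Vfin.
(* The successor keeps [N] positive, so that [N * n] is at least [n] and the constant below is at
   least 1. *)
pose N := N0.+1.
have VN x : x \in V -> lspan (graded_le N) x.
  by move=> /VN0; apply: graded_le_widen; apply: leqnSn.
have [C [M [C1 CM]]] := partial_sum_bound (fun i => ler0n R _) poincare_cvg
  hilbert_serre_dim_pole.
set d := hilbert_serre_dim R G in CM *.
exists (C * N%:R ^+ d), M; split=> [|n Mn].
  by rewrite (le_trans C1) // ler_peMr ?exprn_ege1 ?ler1n // (le_trans ler01).
rewrite -mulrA -exprMn -natrM; apply: le_trans (CM _ _); last first.
  by rewrite (leq_trans Mn) // mulSn leq_addr.
have [u [us uP]] := graded_le_gen (N * n).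
rewrite /poincare_coef -natr_sum ler_nat; apply: leq_trans us.
apply: vdim_le; first exact: subspace_filtration_closed.
move=> x /subspace_filtrationP xV; apply: uP.
apply: lspan_trans xV => y [i iin] /(nprod_graded_le VN).
by apply: graded_le_widen; rewrite mulnC leq_mul2l iin orbT.
Qed.

End HilbertSerre.

(** * Elimination of algebraically dependent generators *)

Section AlgebraicReduction.
Context {k : fieldType} {A : comAlgType k}.
Implicit Types (u w : seq A) (al be : seq nat).

Lemma lspan_mull (S U : A -> Prop) a x :
  (forall s, S s -> lspan U (a * s)) -> lspan S x -> lspan U (a * x).
Proof.
move=> SU Sx; apply: (lspan_mul (S := eq a) _ _ Sx); last exact: lspan_gen.
by move=> _ t <-; apply: SU.
Qed.

Lemma monsM w M N x y : mons w M x -> mons w N y -> mons w (M + N) (x * y).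
Proof.
move=> [al /box_nthP [_ alM] ->] [be /box_nthP [_ beN] ->].
exists (mkseq (fun i => nth 0 al i + nth 0 be i)%N (size w)).
  apply/box_nthP; rewrite size_mkseq; split=> // i.
  have [iw|wi] := ltnP i (size w); last by rewrite nth_default ?size_mkseq.
  by rewrite nth_mkseq // leq_add.
rewrite !monE -big_split; apply: eq_bigr => i _ /=.
by rewrite nth_mkseq // exprD.
Qed.

(** A nontrivial relation is read as a polynomial in [v]; independence of [w] makes one of its
    coefficients nonzero, and [D] is its degree. *)
Lemma not_mon_indep_cons w v : mon_indep w -> ~ mon_indep (v :: w) ->
  exists N D (f : nat -> A), [/\ f D != 0, forall i, lspan (mons w N) (f i)
    & \sum_(i < D.+1) v ^+ i * f i = 0].
Proof.
move=> wi /existsNP [N] /existsNP [c] /not_implyP [c0].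
move=> /existsNP [al] /not_implyP [].
rewrite boxS => /allpairsP [[i be] [iN beN ->]] /= cbe.
rewrite mem_iota in iN.
pose f i := \sum_(al <- box (size w) N) c (i :: al) *: mon w al.
have fN j : lspan (mons w N) (f j).
  apply: (lin_closed_sum (lspan_closed _)) => ga gaN.
  by apply: (lin_closedZ _ (lspan_closed _)); apply: lspan_gen; exists ga.
have fi : f i != 0.
  by apply/eqP => /(wi N (fun al => c (i :: al)))/(_ be beN).
have {c0} : \sum_(j < N.+1) v ^+ j * f j = 0.
  move: c0; rewrite big_box => c0; rewrite -[RHS]c0; apply: eq_bigr => j _.
  by rewrite mulr_sumr; apply: eq_bigr => ga _; rewrite scalerAr.
(* Vanishing top coefficients are dropped one by one; the nonzero [f i] stops the descent. *)
move: iN => /andP [_ iN]; suff: forall n, (i < n)%N ->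
    \sum_(j < n) v ^+ j * f j = 0 -> exists D, f D != 0 /\
    \sum_(j < D.+1) v ^+ j * f j = 0.
  by move=> /(_ _ iN) + s0 => /(_ s0) [D [fD sD]]; exists N, D, f.
elim=> // n IHn; rewrite ltnS leq_eqVlt => iln.
have [fn|fn] := eqVneq (f n) 0; last by exists n.
rewrite big_ord_recr /= fn mulr0 addr0; apply: IHn.
by case/predU1P: iln => // iE; rewrite iE fn eqxx in fi.
Qed.

(** Here [n] counts the factors [f D] spent; each of them raises the exponents in [w] by at most
    [N]. *)
Definition low_power w v N D n (y : A) : Prop :=
  exists z i, [/\ mons w (N * n) z, (i < D)%N & y = z * v ^+ i].

(* Each factor [f D] pays for one rewriting of [v ^+ D] into lower powers. *)
Lemma low_power_reduction w v N D (f : nat -> A) :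
  f D != 0 -> (forall i, lspan (mons w N) (f i)) ->
  \sum_(i < D.+1) v ^+ i * f i = 0 ->
  forall n j, (j <= n)%N -> lspan (low_power w v N D n) (f D ^+ n * v ^+ j).
Proof.
move=> fD fN; rewrite big_ord_recr /= addrC => /eqP; rewrite addr_eq0 => /eqP vD.
have mulL n g i z : lspan (mons w N) g -> (i < D)%N -> mons w (N * n) z ->
    lspan (low_power w v N D n.+1) (g * (z * v ^+ i)).
  move=> gN iD zn; rewrite mulrC; apply: lspan_mull gN => s sN.
  apply: lspan_gen; exists (z * s), i; split=> //.
    by rewrite mulnS addnC; apply: monsM.
  by rewrite mulrAC.
(* For [D = 0] the relation would read [f 0 = 0]. *)
have D0 : (0 < D)%N.
  rewrite lt0n; apply: contraNneq fD => D0.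
  by move: vD; rewrite D0 expr0 mul1r big_ord0 oppr0 => ->.
have stepf n y : lspan (low_power w v N D n) y ->
    lspan (low_power w v N D n.+1) (f D * y).
  by apply: lspan_mull => _ [z [i [zn iD ->]]]; apply: mulL.
have stepv n y : lspan (low_power w v N D n) y ->
    lspan (low_power w v N D n.+1) (f D * v * y).
  apply: lspan_mull => _ [z [i [zn iD ->]]].
  rewrite -mulrA [v * _]mulrCA -exprS.
  (* Only when [i.+1 = D] is the relation used: it turns [f D * v ^+ D] into lower powers of [v]
     with coefficients in the span of [mons w N]. *)
  move: iD; rewrite leq_eqVlt => /predU1P [->|iD]; last exact: mulL.
  rewrite mulrCA [f D * _]mulrC vD mulrN -mulNr mulr_sumr.
  apply: (lin_closed_sum (lspan_closed _)) => i' _.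
  rewrite mulNr -scaleN1r mulrA mulrC.
  by apply: (lin_closedZ _ (lspan_closed _)); apply: mulL.
elim=> [|n IHn] j.
  rewrite leqn0 => /eqP ->; apply: lspan_gen; exists 1, 0%N.
  by rewrite !expr0; split; rewrite ?mulr1 //; apply: mons1.
rewrite leq_eqVlt => /predU1P [->|jn]; last first.
  by rewrite exprS -mulrA; apply: stepf; apply: IHn.
by rewrite !exprS mulrACA; apply: stepv; apply: IHn.
Qed.

Hypothesis domA : GRing.integral_domain_axiom A.

Lemma dom_mul_neq0 x y : x != 0 -> y != 0 -> x * y != 0 :> A.
Proof.
by move=> x0 y0; apply/eqP => /domA /orP []; [exact/negP|exact/negP].
Qed.

Lemma dom_exp_neq0 x n : x != 0 -> x ^+ n != 0 :> A.
Proof.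
by move=> x0; elim: n => [|n IHn]; rewrite ?oner_neq0 // exprS dom_mul_neq0.
Qed.

Definition mons_times w N (S : seq A) (y : A) : Prop :=
  exists z s, [/\ mons w N z, s \in S & y = z * s].

(** Induction on the generators. A new [v] joins [w] if the family stays independent; otherwise its
    high powers are eliminated, the leading coefficient [f D] going into the denominator [c] and the
    powers of [v] below [D] into the finite set [S]. *)
Lemma mons_reduction u : exists w S c B, [/\ mon_indep w, c != 0 &
  forall n x, mons u n x -> lspan (mons_times w (B * n) S) (c ^+ n * x)].
Proof.
elim: u => [|v u [w [S [c [B [wi c0 cP]]]]]].
  exists [::], [:: 1], 1, 0%N; split; rewrite ?oner_neq0 //.
    move=> N d; rewrite big_seq1 => /= /eqP.
    rewrite scaler_eq0 oner_eq0 orbF => /eqP d0 al.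
    by rewrite inE => /eqP ->.
  move=> n _ [al _ ->]; rewrite /= expr1n mulr1; apply: lspan_gen.
  by exists 1, 1; rewrite mulr1; split; rewrite ?inE //; apply: mons1.
have split_mon n x : mons (v :: u) n x ->
    exists j y, [/\ (j <= n)%N, mons u n y & x = v ^+ j * y].
  move=> [al]; rewrite [size _]/= boxS => /allpairsP [[j be] [jn ben ->]] ->.
  exists j, (mon u be); split=> //; last by exists be.
  by move: jn; rewrite mem_iota.
have [vwi|/(not_mon_indep_cons wi) [N [D [f [fD fN f0]]]]] :=
  pselect (mon_indep (v :: w)).
  exists (v :: w), S, c, B.+1; split=> // n _ /split_mon [j [y [jn yn ->]]].
  rewrite mulrCA; apply: lspan_mull (cP _ _ yn) => _ [z [s [[al aln ->] sS ->]]].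
  apply: lspan_gen; exists (v ^+ j * mon w al), s; split; rewrite ?mulrA //.
  exists (j :: al) => //; rewrite [size _]/= boxS.
  apply/allpairsP; exists (j, al); split=> //.
    by rewrite mem_iota ltnS mulSn (leq_trans jn) // leq_addr.
  by apply: box_le aln; rewrite mulSn leq_addl.
exists w, [seq s * v ^+ i | s <- S, i <- iota 0 D], (c * f D), (N + B)%N.
split=> //; first exact: dom_mul_neq0.
move=> n _ /split_mon [j [y [jn yn ->]]].
rewrite exprMn [c ^+ n * _]mulrC mulrACA.
apply: (lspan_mul _ (low_power_reduction fD fN f0 jn) (cP _ _ yn)).
move=> _ _ [z [i [zn iD ->]]] [z' [s [zn' sS ->]]]; apply: lspan_gen.
exists (z * z'), (s * v ^+ i); split.
- by rewrite mulnDl; apply: monsM.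
- by apply/allpairsP; exists (s, i); rewrite mem_iota.
- by rewrite mulrACA [v ^+ i * s]mulrC.
Qed.

(** The constant is written [C.+1] to be at least 1, as [growth_rate_le] asks. *)
Lemma vdim_filtration_le_mons (V : {pred A}) : finite_dim V ->
  exists w C, mon_indep w /\ forall n, (0 < n)%N ->
    (vdim (subspace_filtration V n) <= C.+1 * n ^ size w)%N.
Proof.
move=> Vfin; have [u [Vu _]] := finite_dim_lspan Vfin.
have [w [S [c [B [wi c0 cP]]]]] := mons_reduction u.
(* There are [(B * n).+1 ^ size w * size S] products to count, and [(B * n).+1 <= B.+1 * n] because
   [n] is positive. *)
exists w, (size S * B.+1 ^ size w)%N; split=> // n n0.
have [v vb] := has_dim_filtration n Vfin.
set d := vdim _ in v vb *.
pose M := [seq mon w al * s | al <- box (size w) (B * n), s <- S].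
apply: (@leq_trans (size M)); last first.
  rewrite size_allpairs size_box mulnC.
  apply: (@leq_trans (size S * (B.+1 * n) ^ size w)).
    rewrite leq_mul2l; apply/orP; right.
    by case: (size w) => // e; rewrite leq_exp2r // mulSn -add1n leq_add2r.
  by rewrite expnMn mulnA leq_mul2r leqnSn orbT.
rewrite -[d]size_index_ord.
(* Multiplication by the nonzero [c ^+ n] keeps the basis independent, since [A] is a domain. *)
apply: (lin_indep_size_le (g := fun i => c ^+ n * v i)) => [|e e0 i iI|i _].
- exact: index_enum_uniq.
- apply: (is_basis_lin_indep vb) iI; apply: contrapT => /eqP sum_neq0.
  have /eqP [] := dom_mul_neq0 (dom_exp_neq0 n c0) sum_neq0.
  by rewrite mulr_sumr -[RHS]e0; apply: eq_bigr => j _; rewrite scalerAr.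
- have := subspace_filtration_mons Vu (is_basis_mem i vb).
  move=> /(lspan_mull (cP n)); apply: lspan_sub => _ [_ [s [[al aln ->] sS ->]]].
  by apply/allpairsP; exists (al, s).
Qed.

End AlgebraicReduction.

(** * Exponent lists against multivariate polynomials, and fractions *)

Definition box_mnm n (al : seq nat) : multinom n :=
  Multinom [tuple nth 0%N al i | i < n].

Lemma box_mnmE n al (i : 'I_n) : box_mnm n al i = nth 0%N al i.
Proof. by rewrite multinomE tnth_mktuple. Qed.

Lemma box_mnm_val n (m : multinom n) : box_mnm n m = m.
Proof.
by apply/val_inj/eq_from_tnth => i; rewrite tnth_mktuple (tnth_nth 0%N).
Qed.

Lemma box_mnm_inj n N : {in box n N &, injective (box_mnm n)}.
Proof.
move=> al be /box_nthP [aln _] /box_nthP [ben _] ab.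
apply: (@eq_from_nth _ 0%N) => [|i]; first by rewrite aln ben.
by rewrite aln => lti; rewrite -!(box_mnmE _ (Ordinal lti)) ab.
Qed.

Lemma msupp_box n (K : fieldType) (p : mpoly n K) m :
  m \in msupp p -> (multinom_val m : seq nat) \in box n (msize p).
Proof.
move=> mp; apply/box_nthP; split=> [|i]; first by rewrite size_tuple.
have [ltin|nin] := ltnP i n; last by rewrite nth_default // size_tuple.
apply: (leq_trans _ (ltnW (msize_mdeg_lt mp))).
rewrite mdegE (bigD1 (Ordinal ltin)) //= /fun_of_multinom (tnth_nth 0%N) /=.
exact: leq_addr.
Qed.

(** The sum over the support extends to the box: exponents in the support are below [msize p], and
    coefficients outside it vanish. *)
Lemma mmap_box n (K : fieldType) (B : comNzRingType) (f : {rmorphism K -> B})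
    (x : 'I_n -> B) (p : mpoly n K) :
  mmap f x p = \sum_(al <- box n (msize p))
    f (mcoeff (box_mnm n al) p) * \prod_(i < n) x i ^+ nth 0%N al i.
Proof.
pose F m := f (mcoeff m p) * \prod_(i < n) x i ^+ fun_of_multinom m i.
transitivity (\sum_(m <- [seq box_mnm n al | al <- box n (msize p)]) F m).
  rewrite /mmap [RHS](bigID (fun m => m \in msupp p)) /= [X in _ + X]big1 ?addr0.
    rewrite -[RHS]big_filter; apply: perm_big; apply: uniq_perm.
    - exact: msupp_uniq.
    - by rewrite filter_uniq // map_inj_in_uniq ?box_uniq //; apply: box_mnm_inj.
    move=> m; rewrite mem_filter; case mp : (m \in msupp p) => //=.
    symmetry; apply/mapP; exists (multinom_val m : seq nat).
      exact: msupp_box.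
    by rewrite box_mnm_val.
  by move=> m /memN_msupp_eq0; rewrite /F => ->; rewrite rmorph0 mul0r.
rewrite big_map; apply: eq_bigr => al _; congr (_ * _).
by apply: eq_bigr => i _; rewrite box_mnmE.
Qed.

(** The [c al] assemble into a polynomial vanishing at [x]; distinct lists in the box give distinct
    monomials, so each [c al] is one of its coefficients. *)
Lemma alg_independent_box (K F : fieldType) (f : {rmorphism K -> F}) n
    (x : 'I_n -> F) N (c : seq nat -> K) :
  alg_independent f x ->
  \sum_(al <- box n N) f (c al) * \prod_(i < n) x i ^+ nth 0%N al i = 0 ->
  forall al, al \in box n N -> c al = 0.
Proof.
move=> xi c0 al alN.
pose p : mpoly n K := \sum_(be <- box n N) c be *: mpolyX K (box_mnm n be).
have p0 : p = 0.
  apply: xi; rewrite raddf_sum -[RHS]c0; apply: eq_bigr => be _ /=.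
  rewrite mmapZ mmapX; congr (_ * _); apply: eq_bigr => i _.
  by rewrite box_mnmE.
have : mcoeff (box_mnm n al) p = c al.
  rewrite raddf_sum (bigD1_seq al) ?box_uniq //= mcoeffZ mcoeffX eqxx mulr1.
  rewrite big_seq_cond big1 ?addr0 // => be /andP [beN bal].
  rewrite mcoeffZ mcoeffX (_ : (_ == _) = false) ?mulr0 //.
  by apply: contraNF bal => /eqP /(box_mnm_inj beN alN) ->.
by rewrite p0 mcoeff0.
Qed.

(** Clears the denominator of [x ^+ i] for [x = a / b]. *)
Lemma expr_denomE (B : comNzRingType) (x a b : B) i m :
  (i <= m)%N -> x * b = a -> b ^+ m * x ^+ i = a ^+ i * b ^+ (m - i).
Proof. by move=> im <-; rewrite exprMn -mulrA -exprD subnKC // mulrC. Qed.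

Lemma fraction_numden (D : idomainType) (x : {fraction D}) :
  exists a b : D, b != 0 /\ x * FracField.tofrac b = FracField.tofrac a.
Proof.
elim/quotW: x => r; exists (frac r).1, (frac r).2; split.
  exact: denom_ratioP.
unlock FracField.tofrac; rewrite -[LHS]FracField.pi_mul.
apply/eqmodP; rewrite /= FracField.equivfE /FracField.mulf.
by rewrite !numden_Ratio ?mulf_neq0 ?oner_neq0 ?denom_ratioP // !mulr1 mulrC.
Qed.

(** * Comparison with the transcendence degree *)

Section Transcendence.
Context (R : realType) {k : fieldType} {A : comAlgType k}.
Variable domA : GRing.integral_domain_axiom A.
Local Notation toF := (to_fraction_field domA).

(** The embedding into the field of fractions is injective, so a polynomial relation between the
    images of [w] is already a relation between monomials in [A]. *)
Lemma mon_indep_le_trdeg (w : seq A) : mon_indep w ->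
  (((size w)%:R)%:E <= trdeg R domA)%E.
Proof.
move=> wi; apply: ereal_sup_ubound; exists (size w) => //.
exists (fun i => toF w`_i) => p p0.
pose c al := mcoeff (box_mnm (size w) al) p.
have c0 : forall al, al \in box (size w) (msize p) -> c al = 0.
  apply: wi; have /eqP := p0; rewrite mmap_box.
  under eq_bigr => al _.
    rewrite [X in X * _]/= [X in _ * X](_ : _ = toF (mon w al)); last first.
      by rewrite monE rmorph_prod; apply: eq_bigr => i _; rewrite rmorphXn.
    rewrite -rmorphM mulr_algl.
    over.
  rewrite -raddf_sum => /eqP; rewrite -(rmorph0 toF) => /eqP.
  by rewrite tofrac_eq => /eqP.
apply/mpolyP => m; rewrite mcoeff0.
have [/msupp_box/c0|/memN_msupp_eq0 //] := boolP (m \in msupp p).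
by rewrite /c box_mnm_val.
Qed.

Lemma krull_le_trdeg : (krull_dim R A <= trdeg R domA)%E.
Proof.
apply/ereal_supP => _ [r /prime_chain_mon_indep [w [<- wf]] <-].
exact: mon_indep_le_trdeg.
Qed.

Lemma trdeg_le_GKdim : (trdeg R domA <= GKdim R A)%E.
Proof.
apply/ereal_supP => _ [n [x xi] <-].
have /choice [ab abP] : forall i : 'I_n, exists ab : A * A,
    toF ab.2 != 0 /\ x i * toF ab.2 = toF ab.1.
  move=> i; have [a [b [b0 xab]]] := fraction_numden (x i).
  by exists (a, b); rewrite tofrac_eq0.
(* The families are extended by 0 to all of [nat], the form that [GKdim_ge] takes. *)
pose a i := if insub i is Some j then (ab j).1 else 0.
pose b i := if insub i is Some j then (ab j).2 else 0.
have aE (i : 'I_n) : a i = (ab i).1 by rewrite /a valK.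
have bE (i : 'I_n) : b i = (ab i).2 by rewrite /b valK.
apply: (@GKdim_ge _ _ _ a b) => m c c0; apply: (alg_independent_box xi).
(* Multiplied by this product, the monomial in the [x i] with exponents [al] becomes the image of
   the element of [A] attached to [al] in [GKdim_ge]. *)
have bm : \prod_(i < n) toF (b i) ^+ m != 0.
  by apply/prodf_neq0 => i _; rewrite bE expf_neq0 //; case: (abP i).
apply: (mulfI bm); rewrite mulr0 -[RHS](rmorph0 toF) -c0 rmorph_sum mulr_sumr.
rewrite big_seq [RHS]big_seq; apply: eq_bigr => al /box_nthP [_ alm].
rewrite -mulr_algl rmorphM rmorph_prod mulrCA -big_split; congr (_ * _).
apply: eq_bigr => i _ /=; rewrite rmorphM !rmorphXn.
by rewrite aE bE; apply: expr_denomE (alm i) _; case: (abP i).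
Qed.

Lemma GKdim_le_trdeg : (GKdim R A <= trdeg R domA)%E.
Proof.
apply/ereal_supP => _ [V [Vl Vfin] <-].
have [w [C [wi wC]]] := vdim_filtration_le_mons domA Vfin.
apply: le_trans (mon_indep_le_trdeg wi).
apply: (@growth_rate_le _ _ _ _ (C.+1%:R : R) 1) => [|n /wC].
  by rewrite ler1n.
by rewrite -natrX -natrM ler_nat.
Qed.

End Transcendence.

Theorem theorem1p2 (R : realType) (k : fieldType) (A : comAlgType k)
    (G : nat -> {pred A}) (grG : is_grading G) (hsG : hilbert_serre R G) :
  [/\ (graded_krull_dim R G <= krull_dim R A)%E,
      (krull_dim R A <= GKdim R A)%E
    & (GKdim R A <= ((hilbert_serre_dim R G)%:R : R)%:E)%E] /\
  (forall domA : GRing.integral_domain_axiom A,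
     [/\ (graded_krull_dim R G <= krull_dim R A)%E,
         (krull_dim R A <= trdeg R domA)%E,
         trdeg R domA = GKdim R A
       & (GKdim R A <= ((hilbert_serre_dim R G)%:R : R)%:E)%E]).
Proof.
have gr : (graded_krull_dim R G <= krull_dim R A)%E.
  apply/ereal_supP => _ [r [P [_ PS]] <-].
  by apply: ereal_sup_ubound; exists r => //; exists P.
have gk := GKdim_le_hilbert_serre_dim grG hsG.
split=> [|domA]; split=> //; first exact: krull_le_GKdim.
  exact: krull_le_trdeg.
by apply/eqP; rewrite eq_le trdeg_le_GKdim GKdim_le_trdeg.
Qed.
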